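(* Consider the control system $\dot x=f(x)+g(x)u$ with $f,g$ locally Lipschitz, $x\in\mathbb{R}^n$, $u\in U\subset\mathbb{R}^m$. Let $h:\mathbb{R}^n\to\mathbb{R}$ be continuously differentiable and let $\mathcal{C}\subset\mathbb{R}^n$ be a set such that $\mathcal{C}=\{x:h(x)\ge0\}$, $\partial\mathcal{C}=\{x:h(x)=0\}$, $\mathrm{Int}(\mathcal{C})=\{x:h(x)>0\}$. If $h$ is a zeroing control barrier function on a set $\mathcal{D}$ with $\mathcal{C}\subseteq\mathcal{D}\subset\mathbb{R}^n$, with extended class $\mathcal{K}$ function $\alpha$, then any Lipschitz continuous controller $u:\mathcal{D}\to U$ such that $u(x)\in K_{\mathrm{zcbf}}(x)$ for all $x\in\mathcal{D}$, where $$K_{\mathrm{zcbf}}(x)=\{u\in U: L_fh(x)+L_gh(x)u+\alpha(h(x))\ge0\},$$ renders the set $\mathcal{C}$ forward invariant.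
   Context: $\mathrm{Int}(\mathcal{C})$, $\partial\mathcal{C}$ denote interior and boundary. $L_fh(x)=\frac{\partial h}{\partial x}(x)f(x)$, $L_gh(x)=\frac{\partial h}{\partial x}(x)g(x)$. A continuous function $\alpha:(-b,a)\to(-\infty,\infty)$, for some $a,b>0$ (possibly infinite), is of extended class $\mathcal{K}$ if it is strictly increasing and $\alpha(0)=0$; arguments are understood to lie in the domain. Zeroing control barrier function (ZCBF) on $\mathcal{D}$ (with $\mathcal{C}\subseteq\mathcal{D}\subset\mathbb{R}^n$): there exists an extended class $\mathcal{K}$ function $\alpha$ such that $\sup_{u\in U}[L_fh(x)+L_gh(x)u+\alpha(h(x))]\ge0$ for all $x\in\mathcal{D}$. A controller $u(\cdot)$ renders a set $\mathcal{S}$ forward invariant if, for the closed-loop system $\dot x=f(x)+g(x)u(x)$, every solution with $x(t_0)=x_0\in\mathcal{S}$ satisfies $x(t)\in\mathcal{S}$ for all $t\in I_u(x_0)$, where $I_u(x_0)=[t_0,\tau_{\max})$ is the maximal time interval of existence of the closed-loop solution (forward completeness is not claimed). *)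

(* Defs.v *)
(* MathComp-Analysis.  Vectors of R^n are column vectors 'cV[R]_n, which carry
   the sup norm; all notions below depend only on the norm up to equivalence. *)
From HB Require Import structures.
From mathcomp Require Import all_boot all_order all_algebra.
From mathcomp Require Import all_classical all_reals all_analysis.
Set Implicit Arguments.
Unset Strict Implicit.
Unset Printing Implicit Defensive.
Import Order.TTheory GRing.Theory Num.Theory.
Import numFieldNormedType.Exports.
Local Open Scope classical_set_scope.
Local Open Scope ring_scope.

Definition locally_lipschitz (R : realType) (V W : normedModType R)
    (f : V -> W) : Prop :=
  forall x : V, exists2 A : set V, nbhs x A & [lipschitz f y | y in A].

Definition boundary (T : topologicalType) (A : set T) : set T :=
  closure A `\` A°.

Section control_systems.
Context {R : realType} {n m : nat}.
Implicit Types (f : 'cV[R]_n -> 'cV[R]_n) (g : 'cV[R]_n -> 'M[R]_(n, m)).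
Implicit Types (h : 'cV[R]_n -> R) (D S : set 'cV[R]_n) (U : set 'cV[R]_m).

(* The row vector dh/dx of partial derivatives. *)
Definition gradient h (x : 'cV[R]_n) : 'rV[R]_n :=
  \row_(j < n) 'D_(delta_mx j 0) h x.

Definition continuously_differentiable h : Prop :=
  (forall x, differentiable h x) /\ continuous (gradient h).

(* The product is 1 x 1; the Lie derivative is its only entry. *)
Definition lie_f f h (x : 'cV[R]_n) : R := (gradient h x *m f x) 0 0.

Definition lie_g g h (x : 'cV[R]_n) : 'rV[R]_m := gradient h x *m g x.

(* The open interval (-b, a), where a and b may be +oo. *)
Definition classK_dom (b a : \bar R) : set R :=
  [set y | (- b < y%:E)%E /\ (y%:E < a)%E].

(* Only the values of alpha on (-b, a) matter. *)
Definition extended_classK (b a : \bar R) (alpha : R -> R) : Prop :=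
  [/\ (0 < b)%E /\ (0 < a)%E,
      {within classK_dom b a, continuous alpha},
      forall y z, classK_dom b a y -> classK_dom b a z ->
        y < z -> alpha y < alpha z
    & alpha 0 = 0].

Definition zcbf_expr f g h (alpha : R -> R) (x : 'cV[R]_n) (v : 'cV[R]_m) : R :=
  lie_f f h x + (lie_g g h x *m v) 0 0 + alpha (h x).

(* h is a zeroing control barrier function on D, with witness alpha.  Since
   alpha is defined on (-b, a) only, h must map D into (-b, a).  The supremum
   is taken in the extended reals: it may be +oo, and it is -oo if U is empty. *)
Definition zcbf_with f g U h D (b a : \bar R) (alpha : R -> R) : Prop :=
  [/\ extended_classK b a alpha,
      forall x, D x -> classK_dom b a (h x)
    & forall x, D x ->
        (0%E <= ereal_sup [set (zcbf_expr f g h alpha x v)%:E | v in U])%E].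

Definition K_zcbf f g U h (alpha : R -> R) (x : 'cV[R]_n) : set 'cV[R]_m :=
  [set v | U v /\ 0 <= zcbf_expr f g h alpha x v].

(* The time interval [t0, tau), where tau may be +oo. *)
Definition time_itv (t0 : R) (tau : \bar R) : set R :=
  [set t | t0 <= t /\ (t%:E < tau)%E].

(* x solves x' = F x, x t0 = x0 on [t0, tau).  The field F is only meaningful
   on D, so a solution takes its values in D.  Only the values of x on
   [t0, tau) matter; at t0, where a two-sided derivative would look outside
   this interval, continuity from the right is required. *)
Definition is_solution (F : 'cV[R]_n -> 'cV[R]_n) D (t0 : R) (x0 : 'cV[R]_n)
    (tau : \bar R) (x : R -> 'cV[R]_n) : Prop :=
  [/\ (t0%:E < tau)%E,
      x t0 = x0,
      forall t, time_itv t0 tau t -> D (x t),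
      {within time_itv t0 tau, continuous x}
    & forall t : R, t0 < t -> (t%:E < tau)%E -> is_derive t 1 x (F (x t))].

(* [t0, tau) is the maximal interval of existence of x: x does not extend to a
   solution on a longer interval. *)
Definition is_maximal_solution (F : 'cV[R]_n -> 'cV[R]_n) D (t0 : R)
    (x0 : 'cV[R]_n) (tau : \bar R) (x : R -> 'cV[R]_n) : Prop :=
  is_solution F D t0 x0 tau x /\
  forall (tau' : \bar R) (y : R -> 'cV[R]_n), is_solution F D t0 x0 tau' y ->
    (forall t, time_itv t0 tau t -> time_itv t0 tau' t -> y t = x t) ->
    (tau' <= tau)%E.

Definition closed_loop f g (u : 'cV[R]_n -> 'cV[R]_m) (x : 'cV[R]_n) :
    'cV[R]_n :=
  f x + g x *m u x.

(* u is a controller on D; its values outside D are irrelevant. *)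
Definition renders_forward_invariant f g D (u : 'cV[R]_n -> 'cV[R]_m) S : Prop :=
  forall (t0 : R) (x0 : 'cV[R]_n) (tau : \bar R) (x : R -> 'cV[R]_n),
    S x0 -> is_maximal_solution (closed_loop f g u) D t0 x0 tau x ->
    forall t, time_itv t0 tau t -> S (x t).

End control_systems.

(* Main.v *)
(* Where h is negative, so is alpha o h, hence h strictly increases along every
   trajectory.  If h were negative at some time t1, its minimum over [t0, t1]
   would be negative, hence attained after t0, yet h would be smaller just
   before: a contradiction. *)
Require Import Defs.
From HB Require Import structures.
From mathcomp Require Import all_boot all_order all_algebra.
From mathcomp Require Import all_classical all_reals all_analysis.
Import Order.TTheory GRing.Theory Num.Theory.
Import numFieldNormedType.Exports.
Local Open Scope classical_set_scope.
Local Open Scope ring_scope.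

(** Expanding [v] in the basis [delta_mx j 0] and using linearity of ['d h x] ties the Lie
    derivatives, built from partial derivatives, to the differential that the chain rule yields. *)
Lemma gradient_mulE (R : realType) (n : nat) (h : 'cV[R]_n -> R) (x v : 'cV[R]_n) :
  differentiable h x -> (gradient h x *m v) 0 0 = 'd h x v.
Proof.
move=> dh; rewrite [in RHS](matrix_sum_delta v) linear_sum mxE.
apply: eq_bigr => j _.
by rewrite big_ord1 linearZ mxE deriveE // mulrC.
Qed.

(** The difference quotients at [c] have a positive limit, so they are positive for small
    increments; a negative increment [t - c] then forces a negative numerator. *)
Lemma derive1_gt0_near_left (R : realType) (phi : R -> R) (c : R) :
  derivable phi c 1 -> 0 < 'D_1 phi c -> \forall t \near c^'-, phi t < phi c.
Proof.
move=> dphi /(cvgr_gt _ dphi) [e /= e0 He].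
exists e => //= t /= tc lt_tc.
have t0 : t - c < 0 by rewrite subr_lt0.
have := He (t - c); rewrite /= sub0r normrN distrC => /(_ tc).
rewrite lt_eqF // => /(_ isT).
by rewrite /= scaler1 subrK /GRing.scale /= nmulr_rgt0 ?invr_lt0 // subr_lt0.
Qed.

(** The derivative is constrained only where a trajectory gives control: after [t0], since at [t0] a
    solution is merely right continuous, and at negative values, where [alpha] has a known sign. *)
Lemma ge0_derive1_gt0 (R : realType) (phi : R -> R) (t0 t1 : R) :
  t0 <= t1 -> {within `[t0, t1], continuous phi} -> 0 <= phi t0 ->
  (forall t, t0 < t -> t <= t1 -> phi t < 0 ->
     derivable phi t 1 /\ 0 < 'D_1 phi t) ->
  0 <= phi t1.
Proof.
move=> le01 cphi phi0 dphi; have [c /itvP cI cmin] := EVT_min le01 cphi.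
suff phic : 0 <= phi c.
  by apply: le_trans phic (cmin _ _); rewrite in_itv /= le01 lexx.
rewrite leNgt; apply/negP => phic.
have lt0c : t0 < c.
  rewrite lt_neqAle cI andbT; apply: contraTneq phic => <-.
  by rewrite -leNgt.
have [dc Dc] := dphi _ lt0c ltac:(by rewrite cI) phic.
(* As [t0 < c], points close enough to [c] on its left stay in [[t0, t1]], where [c] is a
   minimizer. *)
near (c^'-) => t.
have : phi t < phi c by near: t; exact: derive1_gt0_near_left.
apply/negP; rewrite -leNgt; apply: cmin; rewrite in_itv /=; apply/andP; split.
  by near: t; exact: nbhs_left_ge.
apply: le_trans (_ : c <= t1); last by rewrite cI.
by near: t; exact: nbhs_left_le.
Unshelve. all: by end_near. Qed.

Theorem corollary2 (R : realType) (n m : nat)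
  (f : 'cV[R]_n -> 'cV[R]_n) (g : 'cV[R]_n -> 'M[R]_(n, m))
  (U : set 'cV[R]_m) (h : 'cV[R]_n -> R) (C D : set 'cV[R]_n)
  (b a : \bar R) (alpha : R -> R)
  (hf : locally_lipschitz f) (hg : locally_lipschitz g)
  (hh : continuously_differentiable h)
  (hC : C = [set x | 0 <= h x])
  (hbC : boundary C = [set x | h x = 0])
  (hiC : C° = [set x | 0 < h x])
  (hCD : C `<=` D)
  (hzcbf : zcbf_with f g U h D b a alpha)
  (u : 'cV[R]_n -> 'cV[R]_m)
  (huU : forall x, D x -> U (u x))
  (hlip : [lipschitz u x | x in D])
  (huK : forall x, D x -> K_zcbf f g U h alpha x (u x)) :
  renders_forward_invariant f g D u C.
Proof.
have [[[b0 a0] _ alpha_lt alpha0] hD _] := hzcbf.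
move=> t0 x0 tau x; rewrite hC /= => hx0 [[_ xt0 xD xc dx] _] t1 [le01 lt1].
have dom0 : classK_dom b a 0 by split => //; rewrite oppe_lt0.
have lt_tau t : t <= t1 -> (t%:E < tau)%E.
  by move=> tt1; apply: le_lt_trans lt1; rewrite lee_fin.
apply: (@ge0_derive1_gt0 _ (h \o x) t0 t1) => //=.
- apply: (@continuous_subspaceW _ _ _ (time_itv t0 tau)).
    by move=> t /=; rewrite in_itv /= => /andP[? ?]; split => //; exact: lt_tau.
  move=> t; apply: (@continuous_comp (subspace (time_itv t0 tau)) _ _ x h); first exact: xc.
  exact: differentiable_continuous (hh.1 _).
- by rewrite xt0.
- move=> t lt0t let1 hxt.
  have [dxt xt'] := dx _ lt0t (lt_tau _ let1).
  have xdiff : differentiable x t by apply/derivable1_diffP.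
  have hdiff : differentiable (h \o x) t by exact: differentiable_comp (hh.1 _).
  have Dxt : D (x t) by apply: xD; split; [exact: ltW|exact: lt_tau].
  split; first by apply/derivable1_diffP.
  (* By the chain rule the derivative of [h \o x] at [t] is ['d h (x t)] applied to the closed-loop
     field, that is $L_fh + L_gh\,u$ at [x t]. *)
  rewrite deriveE // diff_comp //=; last exact: hh.1.
  rewrite -(deriveE _ xdiff) xt' -gradient_mulE; last exact: hh.1.
  have [_] := huK _ Dxt; rewrite /zcbf_expr /lie_f /lie_g.
  rewrite /closed_loop mulmxDr [in X in _ -> X]mxE mulmxA => Kge0.
  (* Membership in [K_zcbf] bounds the derivative below by [- alpha (h (x t))], which is positive by
     strict monotonicity between [h (x t)] and 0. *)
  have : alpha (h (x t)) < 0 by rewrite -alpha0; apply: alpha_lt => //; exact: hD.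
  by move: Kge0; rewrite -lerBlDr sub0r -oppr_gt0 => /[swap]; exact: lt_le_trans.
Qed.
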